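(* Let $\mathbb{K}$ be a field, let $V$ be a vector space over $\mathbb{K}$ with finite positive dimension, and let $A,A^*$ be a tridiagonal pair on $V$ with diameter $d$ and shape $\{\rho_i\}_{i=0}^d$. Then $$\rho_i \leq \rho_0\binom{d}{i}\qquad (0\leq i\leq d).$$
   Context: Let $\mathbb{K}$ be a field and $V$ a vector space over $\mathbb{K}$ with finite positive dimension. For a linear transformation $A:V\to V$, an eigenspace of $A$ is a nonzero subspace of the form $\{v\in V\mid Av=\theta v\}$ with $\theta\in\mathbb{K}$; $A$ is diagonalizable if $V$ is spanned by the eigenspaces of $A$. A tridiagonal pair on $V$ is an ordered pair of linear transformations $A:V\to V$, $A^*:V\to V$ such that: (i) each of $A,A^*$ is diagonalizable; (ii) there is an ordering $\{V_i\}_{i=0}^d$ of the eigenspaces of $A$ with $A^*V_i\subseteq V_{i-1}+V_i+V_{i+1}$ for $0\leq i\leq d$, where $V_{-1}=0$, $V_{d+1}=0$; (iii) there is an ordering $\{V^*_i\}_{i=0}^\delta$ of the eigenspaces of $A^*$ with $AV^*_i\subseteq V^*_{i-1}+V^*_i+V^*_{i+1}$ for $0\leq i\leq\delta$, where $V^*_{-1}=0$, $V^*_{\delta+1}=0$; (iv) there is no subspace $W$ of $V$ with $AW\subseteq W$, $A^*W\subseteq W$, $W\neq 0$, $W\neq V$. (Here $A^*$ is just a name; it does not denote a conjugate-transpose.) An ordering of the eigenspaces of $A$ (resp. $A^*$) as in (ii) (resp. (iii)) is called standard. It is known that $d=\delta$ (called the diameter), that if $\{V_i\}_{i=0}^d$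 is standard then the only other standard ordering is $\{V_{d-i}\}_{i=0}^d$ (similarly for $A^*$), and that for $0\leq i\leq d$ and any standard orderings the spaces $V_i,V^*_i,V_{d-i},V^*_{d-i}$ have the same dimension; this common dimension is denoted $\rho_i$. The sequence $\{\rho_i\}_{i=0}^d$ is called the shape of $A,A^*$. *)

(* Defs.v *)
From mathcomp Require Import all_boot all_algebra.

Set Implicit Arguments.
Unset Strict Implicit.
Unset Printing Implicit Defensive.

Import GRing.Theory.
Local Open Scope ring_scope.

Section TridiagonalPair.

Variables (K : fieldType) (V : vectType K).
Implicit Types (A As : 'End(V)) (U W : {vspace V}).

Definition is_eigenspace A U : Prop :=
  U != 0%VS /\ exists theta : K, U = passmx.leigenspace A theta.

Definition diagonalizable_lfun A : Prop :=
  exists s : seq {vspace V},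
    (forall U, U \in s -> is_eigenspace A U) /\
    (\sum_(U <- s) U)%VS = fullv.

Definition eigenspace_ordering A d (E : d.+1.-tuple {vspace V}) : Prop :=
  uniq E /\ forall U, U \in E <-> is_eigenspace A U.

(* With E = (V_0, ..., V_d), the three summands below are V_{i-1}, V_i and
   V_{i+1}: the shift by 0%VS :: _ and the default value 0%VS of nth encode the
   conventions V_{-1} = 0 and V_{d+1} = 0. *)
Definition standard_ordering A As d (E : d.+1.-tuple {vspace V}) : Prop :=
  eigenspace_ordering A E /\
  forall i, (i <= d)%N ->
    (As @: nth 0%VS E i <=
       nth 0%VS (0%VS :: E) i + nth 0%VS E i + nth 0%VS E i.+1)%VS.

Definition tridiagonal_pair A As : Prop :=
  [/\ diagonalizable_lfun A /\ diagonalizable_lfun As,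
      exists d (E : d.+1.-tuple {vspace V}), standard_ordering A As E,
      exists delta (Es : delta.+1.-tuple {vspace V}),
        standard_ordering As A Es
    & ~ exists W, [/\ (A @: W <= W)%VS, (As @: W <= W)%VS,
                      W != 0%VS & W != fullv]].

(* For a tridiagonal pair, d and rho do not depend on the standard ordering,
   nor on whether it is an ordering for A or for As.  This is a theorem, so it
   is not built into the definition: any one standard ordering of either map
   may serve to read off the diameter d and the shape rho. *)
Definition has_diameter_shape A As d (rho : 'I_d.+1 -> nat) : Prop :=
  exists E : d.+1.-tuple {vspace V},
    (standard_ordering A As E \/ standard_ordering As A E) /\
    forall i : 'I_d.+1, rho i = \dim (tnth E i).

End TridiagonalPair.

(* Main.v *)
Require Import Defs.
From mathcomp Require Import all_boot all_algebra.
From mathcomp Require Import zify.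

(** Let E_0, ..., E_d be the standard ordering from which the shape is read, let
    F_0, ..., F_delta be a standard ordering for the other map, and let e_i and
    f_k be the projections onto E_i and F_k.  By irreducibility V is spanned by
    the vectors
<<
      e_{x_n} f_{x_{n-1}} ... e_{x_2} f_{x_1} v      (n even, v in E_0),
>>
    so E_i is spanned by those with x_n = i.  Each word x_1, ..., x_n
    contributes a subspace of dimension at most dim E_0, and the theorem follows
    once 'C(d, i) words are shown to suffice.

    The only relations used come from the tridiagonal action.  If B is the map
    with eigenspaces F_k and eigenvalues theta_k, then e_j B^r e_i = 0 for
    r < |i - j|, that is, sum_k theta_k^r e_j f_k e_i = 0.  As the theta_k are
    distinct, a Vandermonde argument expresses any |i - j| of the vectors
    e_j f_k e_i x through the remaining ones; the same holds with e and f
    exchanged ([eliminate_letter]).  Two overlapping instances of this give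
    [eliminate_two_letters].

    Put x_0 = 0.  A word is called reduced when x_m > x_{m-2} and
    x_m + x_{m-1} <= delta for all m.  If x_m + x_{m-1} > delta, or if
    x_m <= x_{m-2}, elimination rewrites the word as a combination of words with
    the same last letter which are smaller for the lexicographic order that
    reads x_1 first, or shorter: a word passing through e_0 restarts from E_0
    ([rewrite_large_sum], [rewrite_small_letter]).  Hence the reduced words span
    ([reduced_words_span]).  With the F_k numbered backwards, a reduced word is
    a zigzag path starting at 0 whose steps become shorter and shorter; Pascal's
    rule shows that at most 'C(delta, i) of them end at i
    ([reduced_words_bound]).

    Finally delta <= d, by the classical argument with the subspaces
    (F_0 + ... + F_i) :&: (E_i + ... + E_d) ([diameter_le]). *)

Set Implicit Arguments.
Unset Strict Implicit.
Unset Printing Implicit Defensive.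

Import GRing.Theory.
Local Open Scope ring_scope.

(** * Tridiagonal systems *)

(** The projections attached to a tridiagonal pair with chosen standard
    orderings.  Since the two maps play symmetric roles, everything is indexed by
    a boolean: [e t k] projects onto the k-th eigenspace of [M t], with
    eigenvalue [a t k].  Setting [e t k] to zero for k > N t allows arbitrary
    natural numbers as indices. *)
Record td_system (K : fieldType) (V : vectType K) (N : bool -> nat)
    (M : bool -> 'End(V)) (e : bool -> nat -> 'End(V)) (a : bool -> nat -> K) :
    Prop := TDSystem {
  td_sum : forall t x, \sum_(k < (N t).+1) e t k x = x;
  td_proj : forall t i j x, e t i (e t j x) = if i == j then e t i x else 0;
  td_out : forall t i, (N t < i)%N -> e t i = 0;
  td_neq0 : forall t i, (i <= N t)%N -> e t i != 0;
  td_eig : forall t k x, M t (e t k x) = a t k *: e t k x;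
  td_inj : forall t i j, (i <= N t)%N -> (j <= N t)%N -> a t i = a t j -> i = j;
  td_tri : forall t i j x, (i.+1 < j)%N || (j.+1 < i)%N ->
    e t j (M (~~ t) (e t i x)) = 0;
  td_irr : forall W : {vspace V}, (forall t, M t @: W <= W)%VS ->
    W = 0%VS \/ W = fullv }.

(** * Elimination of letters *)

Section Elimination.

Variables (K : fieldType) (V : vectType K) (N : bool -> nat).
Variables (M : bool -> 'End(V)) (e : bool -> nat -> 'End(V)).
Variable (a : bool -> nat -> K).
Hypothesis sys : td_system N M e a.

Implicit Types (G : 'End(V)) (S : {vspace V}) (t : bool) (x v : V).

Lemma iter_eigen t r x :
  iter r (M t) x = \sum_(k < (N t).+1) a t k ^+ r *: e t k x.
Proof.
elim: r => [|r IHr] /=.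
  rewrite -[LHS](td_sum sys t); apply: eq_bigr => k _.
  by rewrite expr0 scale1r.
rewrite IHr linear_sum; apply: eq_bigr => k _.
by rewrite linearZ /= (td_eig sys) scalerA exprSr.
Qed.

(** One application of [M (~~ t)] moves by at most one step along the eigenspaces
    of [M t], so fewer than |i - j| applications do not lead from the i-th to the
    j-th.  In natural number arithmetic |i - j| is (i - j) + (j - i). *)
Lemma tridiagonal_iter t i j r x : (r < (i - j) + (j - i))%N ->
  e t j (iter r (M (~~ t)) (e t i x)) = 0.
Proof.
elim: r j => [|r IHr] j lt_r /=.
  by rewrite (td_proj sys); case: eqP lt_r => // ->; rewrite subnn.
rewrite -[iter r _ _](td_sum sys t) !linear_sum big1 // => k _ /=.
have [far|near] := boolP ((k.+1 < j) || (j.+1 < k))%N.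
  by rewrite (td_tri sys).
by rewrite IHr ?linear0 //; lia.
Qed.

Lemma vandermonde_relation t i j x (p : {poly K}) :
  (size p <= (i - j) + (j - i))%N ->
  \sum_(k < (N (~~ t)).+1)
     p.[a (~~ t) k] *: e t j (e (~~ t) k (e t i x)) = 0.
Proof.
move=> szp.
transitivity (\sum_(r < size p)
    p`_r *: e t j (iter r (M (~~ t)) (e t i x))); last first.
  rewrite big1 // => r _; rewrite tridiagonal_iter ?scaler0 //.
  exact: leq_trans (ltn_ord r) szp.
under [RHS]eq_bigr => r _ do rewrite iter_eigen linear_sum scaler_sumr.
rewrite exchange_big; apply: eq_bigr => k _.
rewrite horner_coef scaler_suml; apply: eq_bigr => r _.
by rewrite linearZ scalerA.
Qed.

(** A family of |i - j| indices k is no larger than the number of relations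
    between the vectors [e t j (e (~~ t) k (e t i x))], so these vectors lie in S
    as soon as those with k outside the family do.  The map [G] stands for the
    letters applied afterwards. *)
Lemma eliminate_letter t i j x G S (B : seq nat) :
  (size B <= (i - j) + (j - i))%N ->
  (forall k, k \notin B -> G (e t j (e (~~ t) k (e t i x))) \in S) ->
  forall k, G (e t j (e (~~ t) k (e t i x))) \in S.
Proof.
move=> szB outB k0.
have [k0B|] := boolP (k0 \in B); last exact: outB.
have [k0N|k0N] := leqP k0 (N (~~ t)); last first.
  by rewrite (td_out sys k0N) zero_lfunE !linear0 mem0v.
(* The Lagrange polynomial of k0: it kills the other values in B. *)
pose B' := [seq l <- B | (l != k0) && (l <= N (~~ t))%N].
pose p : {poly K} := \prod_(l <- B') ('X - (a (~~ t) l)%:P).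
have szp : (size p <= (i - j) + (j - i))%N.
  rewrite size_prod_XsubC; apply: leq_trans szB.
  rewrite size_filter ltn_neqAle count_size andbT -all_count.
  by apply/allPn; exists k0 => //; rewrite eqxx.
have p_root k : k \in B' -> p.[a (~~ t) k] = 0.
  move=> kB; apply/eqP; rewrite horner_prod prodf_seq_eq0.
  by apply/hasP; exists k => //=; rewrite hornerXsubC subrr.
have p_k0 : p.[a (~~ t) k0] != 0.
  rewrite horner_prod prodf_seq_neq0; apply/allP => l.
  rewrite mem_filter => /andP[/andP[ne_l le_l] _] /=.
  rewrite hornerXsubC subr_eq0; apply: contraNneq ne_l => eq_a.
  by rewrite (td_inj sys le_l k0N).
have := congr1 G (vandermonde_relation t x szp).
rewrite (bigD1 (Ordinal (k0N : k0 < (N (~~ t)).+1)%N)) //= linear0 linearD.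
rewrite linear_sum linearZ => /eqP; rewrite addr_eq0 => /eqP sumS.
rewrite -[X in X \in S](scalerK p_k0) memvZ // sumS memvN memv_suml // => k nek.
rewrite linearZ /=.
have [kB|kB] := boolP (nat_of_ord k \in B); last by rewrite memvZ ?outB.
rewrite p_root ?scale0r ?mem0v // mem_filter kB andbT -ltnS ltn_ord andbT.
by apply: contra nek => /eqP kk0; apply/eqP/val_inj.
Qed.

(** In a word with successive letters i, k, j, h, the two middle letters can be
    changed at the same time so that k becomes smaller than h or j becomes at
    most i. *)
Lemma eliminate_two_letters t i h x G S :
  (forall k j, (k < h)%N || (j <= i)%N ->
     G (e (~~ t) h (e t j (e (~~ t) k (e t i x)))) \in S) ->
  forall k j, G (e (~~ t) h (e t j (e (~~ t) k (e t i x)))) \in S.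
Proof.
move=> outer.
pose u k j := G (e (~~ t) h (e t j (e (~~ t) k (e t i x)))).
suff peel n c b : ((c - h) + (b - i) <= n)%N ->
    (forall k j, [|| k < h, c < k, j <= i | b < j]%N -> u k j \in S) ->
    forall k j, u k j \in S.
  apply: (@peel _ (N (~~ t)) (N t) (leqnn _)) => k j.
  case/or4P=> kj; first by apply: outer; rewrite kj.
  - by rewrite /u (td_out sys kj) zero_lfunE !linear0 mem0v.
  - by apply: outer; rewrite kj orbT.
  - by rewrite /u (td_out sys kj) zero_lfunE !linear0 mem0v.
(* The pairs (k, j) still to be treated form the grid h <= k <= c, i < j <= b.
   Row k = c has b - i entries and c - h relations; column j = b has c - h + 1
   entries and b - i relations.  So the last row or the last column can always be
   cleared. *)
elim: n c b => [|n IHn] c b le_n outS.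
  by move=> k j; apply: outS; lia.
have [cb|cb] := boolP ((c < h) || (b <= i))%N.
  by move=> k j; apply: outS; lia.
have [le_bc|lt_cb] := leqP (b - i) (c - h).
  apply: (IHn c.-1 b) => [|k j]; first lia.
  case: (ltngtP k c) => [lt_kc|lt_ck|->] kj; try by apply: outS; lia.
  have /= := @eliminate_letter (~~ t) c h (e t i x) G S (iota i.+1 (b - i)).
  rewrite negbK size_iota; apply=> [|j']; first lia.
  by rewrite mem_iota => j'B; apply: outS; lia.
apply: (IHn c b.-1) => [|k j]; first lia.
case: (ltngtP j b) => [lt_jb|lt_bj|->] kj; try by apply: outS; lia.
have := @eliminate_letter t i b x (G \o e (~~ t) h)%VF S (iota h (c - h).+1).
rewrite size_iota => elim_k; rewrite /u.
rewrite -[G _]comp_lfunE; apply: elim_k => [|k']; first lia.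
by rewrite mem_iota comp_lfunE => k'B; apply: outS; lia.
Qed.

End Elimination.

(** * Reduced words *)

(** A word is written with the letter applied last at its head, as
    [:: x_n; ...; x_1], and is completed by x_0 = 0.  This is the least x_{n+1}
    that exceeds x_{n-1}; for n = 0 there is no constraint. *)
Definition next_min (r : seq nat) : nat :=
  if r is _ :: r' then (head 0 r').+1 else 0.

Fixpoint reduced (n : nat) (r : seq nat) : bool :=
  if r is c :: r' then
    [&& reduced n r', next_min r' <= c & head 0 r' + c <= n]%N
  else true.

(** The lexicographic order that compares the letters applied first, those at the
    end of the list, before the others. *)
Fixpoint deeplex (r r' : seq nat) : bool :=
  match r, r' with
  | c :: s, c' :: s' => deeplex s s' || ((s == s') && (c < c')%N)
  | _, _ => false
  end.

(** The order is well founded on all words, although letters are unbounded,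
    because only words of the same length are comparable. *)
Lemma deeplex_ind (P : seq nat -> Prop) :
  (forall r, (forall r', deeplex r' r -> P r') -> P r) -> forall r, P r.
Proof.
move=> step r; elim: r P step => [|c s IHs] P step.
  by apply: step => -[].
move: s c {IHs}(IHs (fun s => forall c, P (c :: s))) => s c; apply=> {c}s IHs c.
have [n] := ubnP c; elim: n c => // n IHn c; rewrite ltnS => le_cn.
apply: step => -[|c' s'] //= /orP[/IHs//|/andP[/eqP-> lt_c'c]].
by apply: IHn; apply: leq_trans le_cn.
Qed.

Lemma deeplex_size r r' : deeplex r r' -> size r = size r'.
Proof.
elim: r r' => [|c s IHs] [|c' s'] //= /orP[/IHs->//|/andP[/eqP->]//].
Qed.

Lemma deeplex_cat q r r' : deeplex r r' -> deeplex (q ++ r) (q ++ r').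
Proof. by move=> lt_rr'; elim: q => //= c q ->. Qed.

Lemma unreduced_split n r : ~~ reduced n r ->
  exists q c p, [/\ r = q ++ c :: p, reduced n p
     & (c < next_min p)%N || (n < head 0 p + c)%N].
Proof.
elim: r => // c r IHr /=.
have [red_r|/IHr[q [c' [p [-> red_p bad]]]] _] := boolP (reduced n r).
  rewrite /= negb_and -!ltnNge => bad; exists [::], c, r.
  by split.
by exists (c :: q), c', p.
Qed.

(** Read from its last letter, a reduced word consists of two interleaved strictly
    decreasing sequences: the letters of odd position, here called upper, and the
    positive letters of even position.  [up] tells whether the next letter is
    upper, and [a] and [b] are strict bounds for the next letter of each kind. *)
Fixpoint descending (up : bool) (a b : nat) (r : seq nat) : bool :=
  if r is c :: r' then
    if up then (c < a)%N && descending false c b r'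
    else [&& 0 < c, c < b & descending true a c r']%N
  else true.

(** Pascal's rule: the next letter either takes the largest value allowed, which
    leaves a word starting with a letter of the other kind, or obeys a smaller
    bound. *)
Lemma descending_words_bound a b :
  (exists gl, (size gl <= 'C(a + b, b.+1))%N /\
     forall r, odd (size r) -> descending true a b.+1 r -> r \in gl) /\
  (exists gl, (size gl <= 'C(a + b, b))%N /\
     forall r, ~~ odd (size r) -> descending false a b.+1 r -> r \in gl).
Proof.
have [n] := ubnP (a + b); elim: n a b => // n IHn a b; rewrite ltnS => le_n.
split.
  case: a le_n => [|a] le_n; first by exists [::]; split=> // -[].
  have [] := IHn a b; first by rewrite -ltnS.
  case=> [gl [sz_gl in_gl]] [gl' [sz_gl' in_gl']].
  exists ([seq a :: r | r <- gl'] ++ gl); split.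
    by rewrite size_cat size_map addSn binS addnC leq_add.
  case=> [|x r] //= even_r /andP[]; rewrite ltnS leq_eqVlt mem_cat.
  case/orP=> [/eqP->|lt_xa] dec_r.
    by rewrite map_f ?in_gl'.
  by rewrite in_gl ?orbT //= lt_xa.
case: b le_n => [|b] le_n.
  exists [:: [::]]; split; first by rewrite bin0.
  by case=> [|x r] //= _ /andP[/leq_trans lt0x /andP[/lt0x]].
have [] := IHn a b; first by rewrite -ltnS -addnS.
case=> [gl [sz_gl in_gl]] [gl' [sz_gl' in_gl']].
exists ([seq b.+1 :: r | r <- gl] ++ gl'); split.
  by rewrite size_cat size_map addnS binS leq_add.
case=> [|x r] /= odd_r; first by rewrite mem_cat in_gl' ?orbT.
rewrite negbK in odd_r; case/and3P=> x_gt0; rewrite ltnS leq_eqVlt mem_cat.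
case/orP=> [/eqP->|lt_xb] dec_r.
  by rewrite map_f ?in_gl.
by rewrite in_gl' ?orbT //= ?negbK // x_gt0 lt_xb.
Qed.

Lemma reduced_descending n a b r : reduced n r ->
  (odd (size r) -> head 0 r < a -> head 0 (behead r) < b ->
     descending true a b r)%N /\
  (~~ odd (size r) -> head 0 r < b -> head 0 (behead r) < a ->
     descending false a b r)%N.
Proof.
elim: r a b => [|c r IHr] a b //= /and3P[red_r lt_c _].
have [dec_odd dec_even] :=
  IHr (if odd (size r) then a else c) (if odd (size r) then c else b) red_r.
have lt_c2 : r != [::] -> (head 0 (behead r) < c)%N.
  by case: (r) lt_c.
split=> [/negPf|/negbNE] odd_r lt1 lt2; rewrite odd_r in dec_odd dec_even *.
  rewrite lt1; case: (r) lt_c2 dec_even lt2 => // x r' lt_c2 dec_even lt2.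
  by apply: dec_even => //; apply: lt_c2.
rewrite lt1 dec_odd ?andbT ?lt_c2 //; last by case: (r) odd_r.
by case: (r) odd_r lt_c => //= x r' _; apply: leq_trans.
Qed.

Lemma reduced_words_bound n i :
  exists gl, (size gl <= 'C(n, i))%N /\
    forall r, reduced n r -> ~~ odd (size r) -> head 0 r = i -> r \in gl.
Proof.
have [lt_ni|le_in] := ltnP n i.
  exists [::]; split=> // -[|c r] /= red_r _ hd_r.
    by rewrite -hd_r in lt_ni.
  by case/and3P: red_r; rewrite hd_r; lia.
case: i le_in => [|i] le_in.
  exists [:: [::]]; split; first by rewrite bin0.
  case=> [|c r] //=; rewrite negbK => /and3P[_ lt_c _] odd_r c0.
  by move: lt_c; rewrite c0; case: (r) odd_r.
have [[gl [sz_gl in_gl]] _] := descending_words_bound (n - i) i.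
rewrite subnK ?(ltnW le_in) // in sz_gl.
(* Below the last letter c = i.+1, the upper letters are at most n - c and the
   others lie strictly between 0 and c. *)
exists [seq i.+1 :: r | r <- gl]; rewrite size_map; split=> //.
case=> [|c r] //= /and3P[red_r lt_c le_c]; rewrite negbK => odd_r def_c.
rewrite def_c map_f // in_gl //.
have [dec_r _] := reduced_descending (n - i) i.+1 red_r.
apply: dec_r => //; first lia.
by case: (r) odd_r lt_c => //= x r' _; rewrite def_c.
Qed.

(** * Reduced words span *)

Section Words.

Variables (K : fieldType) (V : vectType K) (N : bool -> nat).
Variables (M : bool -> 'End(V)) (e : bool -> nat -> 'End(V)).
Variable (a : bool -> nat -> K).
Hypothesis sys : td_system N M e a.

Implicit Types (G : 'End(V)) (S : {vspace V}) (t : bool) (x v : V).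

(** The letter x_m is a projection of type [odd m]; the type is recovered from the
    number of letters below it.  Words are applied to vectors of the 0-th
    eigenspace of [M false], which accounts for x_0 = 0. *)
Fixpoint word_map (r : seq nat) : 'End(V) :=
  if r is c :: r' then (e (~~ odd (size r')) c \o word_map r')%VF else \1%VF.

Lemma word_map_cons c r v :
  word_map (c :: r) v = e (~~ odd (size r)) c (word_map r v).
Proof. by rewrite /= comp_lfunE. Qed.

Lemma proj_word_map r v : e false 0 v = v ->
  e (odd (size r)) (head 0 r) (word_map r v) = word_map r v.
Proof.
case: r => [|c r] v0 /=; first by rewrite id_lfunE.
by rewrite comp_lfunE (td_proj sys) eqxx.
Qed.

(** If x_{m-1} + x_m is too large, x_{m-1} can be replaced by smaller letters and
    by letters so large that their sum with x_{m-2} exceeds the bound; the latter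
    are treated by the same argument one place deeper.  At the bottom the sum
    with x_0 = 0 is too large only for letters whose projection is zero. *)
Lemma rewrite_large_sum r c v G S : e false 0 v = v -> reduced (N true) r ->
  (N true < head 0 r + c)%N ->
  (forall r', deeplex r' r -> G (word_map (c :: r') v) \in S) ->
  G (word_map (c :: r) v) \in S.
Proof.
move=> v0; elim: r c G => [|k r IHr] j G /=.
  move=> _ lt_Nc _.
  by rewrite comp_lfunE (td_out sys) // zero_lfunE linear0 mem0v.
case/and3P=> red_r _ le_kN lt_N lex.
rewrite !comp_lfunE -[word_map r v](proj_word_map r v0) negbK.
(* With i the letter below k and N = N true, the values of k from N - j + 1 to
   N - i are eliminated: at most j - i of them, because i <= N - k < j. *)
have := @eliminate_letter _ _ _ _ _ _ sys (odd (size r)) (head 0%N r) j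
  (word_map r v) G S
  (iota ((N true).+1 - j) (((N true).+1 - head 0 r) - ((N true).+1 - j)))%N.
rewrite size_iota; apply=> [|k']; first lia.
rewrite mem_iota proj_word_map // => k'B.
have [lt_k'k|le_kk'] := ltnP k' k.
  have /= := lex (k' :: r); rewrite !comp_lfunE negbK; apply.
  by rewrite eqxx lt_k'k orbT.
have := IHr k' (G \o e (odd (size r)) j)%VF red_r.
rewrite word_map_cons comp_lfunE; apply=> [|r' lt_r'r]; first lia.
have /= := lex (k' :: r'); rewrite !comp_lfunE (deeplex_size lt_r'r) negbK.
by apply; rewrite lt_r'r.
Qed.

(** Suppose that x_{m+1} = j <= x_{m-1}.  Changing x_{m-1} and x_m together makes
    x_{m-1} smaller than j, a smaller word, or x_m at most x_{m-2}, the same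
    situation one place deeper.  At the bottom a letter of even position
    becomes 0, and the word restarts from there as a shorter word [q]. *)
Lemma rewrite_small_letter r j k v G S : e false 0 v = v ->
  (j <= head 0 r)%N ->
  (forall r' k', deeplex r' r -> G (word_map [:: j, k' & r'] v) \in S) ->
  (forall (q : seq nat) v', e false 0 v' = v' -> (size q < (size r).+2)%N ->
     odd (size q) = odd (size r) -> head 0 q = j -> G (word_map q v') \in S) ->
  G (word_map [:: j, k & r] v) \in S.
Proof.
move=> v0; elim: r j k G => [|i r IHr] j k G /=.
  rewrite leqn0 => /eqP-> _ again; rewrite !comp_lfunE id_lfunE.
  rewrite -[e false 0 _]id_lfunE; apply: (again [::]) => //.
  by rewrite (td_proj sys) eqxx.
move=> le_ji lex again.
rewrite !comp_lfunE !negbK -[word_map r v](proj_word_map r v0).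
apply: (eliminate_two_letters sys) => {}k i' /orP[lt_kj|le_i'].
  rewrite proj_word_map //.
  have /= := lex (k :: r) i'; rewrite !comp_lfunE !negbK; apply.
  by rewrite eqxx (leq_trans lt_kj le_ji) orbT.
rewrite proj_word_map //.
have := IHr i' k (G \o e (~~ odd (size r)) j)%VF le_i'.
rewrite /= !comp_lfunE negbK; apply=> [r' k' lt_r'r|q v' v'0 lt_q odd_q hd_q].
  have /= := lex (k' :: r') i'.
  rewrite !comp_lfunE (deeplex_size lt_r'r) !negbK; apply.
  by rewrite lt_r'r.
by have := again (j :: q) v'; rewrite /= !comp_lfunE odd_q; apply.
Qed.

(** Induction on the length and, for a fixed length, on the lexicographic order:
    the rewriting lemmas apply at the first place where a word fails to be
    reduced, and keep the letters from there on. *)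
Lemma reduced_words_span i S :
  (forall r v, e false 0 v = v -> reduced (N true) r -> ~~ odd (size r) ->
     head 0 r = i -> word_map r v \in S) ->
  forall r v, e false 0 v = v -> ~~ odd (size r) -> head 0 r = i ->
    word_map r v \in S.
Proof.
move=> redS r; have [n] := ubnP (size r); elim: n r => // n IHn r.
elim/deeplex_ind: r => r IHr; rewrite ltnS => le_rn v v0 even_r hd_r.
have [red_r|] := boolP (reduced (N true) r); first exact: redS.
(* c is the first letter at which r fails to be reduced. *)
case/unreduced_split=> [q [c [p [def_r red_p bad]]]].
have smaller p' : deeplex p' p -> word_map (q ++ c :: p') v \in S.
  move=> lt_p'p; have sz_p' := deeplex_size lt_p'p.
  apply: IHr => //.
  - by rewrite def_r; apply: deeplex_cat => /=; rewrite lt_p'p.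
  - by move: le_rn; rewrite def_r !size_cat /= sz_p'.
  - by move: even_r; rewrite def_r !size_cat /= sz_p'.
  - by move: hd_r; rewrite def_r; case: (q).
(* G applies the letters of q, with the types they have above c :: p. *)
have [G G_word] : exists G, forall p' u,
    odd (size p') = ~~ odd (size p) -> G (word_map p' u) = word_map (q ++ p') u.
  elim: (q) => [|b q' [G IHG]].
    by exists \1%VF => p' u _; rewrite id_lfunE.
  exists (e (odd (size (q' ++ p))) b \o G)%VF => p' u odd_p'.
  rewrite comp_lfunE IHG // cat_cons word_map_cons.
  by rewrite !size_cat !oddD odd_p' addbN negbK.
rewrite def_r -G_word //.
have smallerG p' : deeplex p' p -> G (word_map (c :: p') v) \in S.
  move=> lt_p'p; rewrite G_word ?smaller //=.
  by rewrite (deeplex_size lt_p'p).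
have [lt_c|le_c] := ltnP c (next_min p); last first.
  apply: rewrite_large_sum => //; move: bad; lia.
case: p => [//|j p] in def_r red_p lt_c G_word smallerG {smaller bad} *.
apply: rewrite_small_letter => // [p' j' lt_p'p|q' v' v'0 lt_q' odd_q' hd_q'].
  by apply: smallerG; rewrite /= lt_p'p.
rewrite G_word; last by rewrite /= negbK.
move: le_rn even_r hd_r; rewrite def_r !size_cat => le_rn even_r hd_r.
apply: IHn => //; rewrite ?size_cat.
- by move: le_rn => /=; lia.
- by move: even_r; rewrite !oddD odd_q' /= negbK.
- by move: hd_r; case: (q) => [|b q''] //= <-.
Qed.

End Words.

(** * The shape and the diameter of a tridiagonal system *)

Section Shape.

Variables (K : fieldType) (V : vectType K) (N : bool -> nat).
Variables (M : bool -> 'End(V)) (e : bool -> nat -> 'End(V)).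
Variable (a : bool -> nat -> K).
Hypothesis sys : td_system N M e a.

Definition word_vector i x := exists r v,
  [/\ e false 0 v = v, ~~ odd (size r), head 0 r = i & x = word_map e r v].

(** The images of the 0-th eigenspace under the reduced words ending in i give S.
    The last clause, stated in the form in which it is used, says that S is no
    larger than the span of the word vectors. *)
Lemma words_space i : exists S : {vspace V},
  [/\ (\dim S <= \dim (limg (e false 0)) * 'C(N true, i))%N,
      forall x, word_vector i x -> x \in S
    & forall (f : 'End(V)) (U : {vspace V}),
        (forall x, word_vector i x -> f x \in U) ->
        forall x, x \in S -> f x \in U].
Proof.
have [gl0 [sz_gl0 in_gl0]] := reduced_words_bound (N true) i.
pose gl := [seq r <- gl0 | ~~ odd (size r) && (head 0%N r == i)].
exists (\sum_(r <- gl) (word_map e r @: limg (e false 0)))%VS; split.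
- apply: leq_trans (dimv_leq_sum _ _ _) _.
  apply: (@leq_trans (\sum_(r <- gl) \dim (limg (e false 0)))).
    apply: leq_sum => r _; rewrite -[leqRHS](limg_ker_dim (word_map e r)).
    exact: leq_addl.
  rewrite big_const_seq count_predT iter_addn_0 leq_mul2l size_filter.
  by rewrite (leq_trans (count_size _ _) sz_gl0) orbT.
- move=> _ [r [v [v0 even_r hd_r ->]]].
  apply: (reduced_words_span sys) v0 even_r hd_r.
  move=> {}r {}v v0 red_r even_r hd_r.
  have r_gl : r \in gl by rewrite mem_filter even_r hd_r eqxx in_gl0.
  rewrite (big_rem r) //=; apply: subvP (addvSl _ _) _ _.
  by rewrite memv_img // -v0 memv_img ?memvf.
move=> f U fU x; rewrite big_seq => xS.
have: (f @: (\sum_(r <- gl | r \in gl) word_map e r @: limg (e false 0))%VS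
       <= U)%VS.
  rewrite limg_sum; elim/big_ind: _ => [||r].
  - exact: sub0v.
  - by move=> U1 U2 sU1 sU2; rewrite subv_add sU1.
  rewrite mem_filter => /andP[/andP[even_r /eqP hd_r] _].
  apply/subvP=> _ /memv_imgP[_ /memv_imgP[_ /memv_imgP[u _ ->] ->] ->].
  apply: fU; exists r, (e false 0 u); split=> //.
  by rewrite (td_proj sys).
by move/subvP; apply; apply: memv_img.
Qed.

Lemma proj_comm t k x : e t k (M t x) = a t k *: e t k x.
Proof.
have [le_kN|lt_Nk] := leqP k (N t); last first.
  by rewrite (td_out sys lt_Nk) !zero_lfunE scaler0.
rewrite -[in LHS](td_sum sys t x) !linear_sum.
rewrite (bigD1 (Ordinal (le_kN : k < (N t).+1)%N)) //= big1 => [|l nel].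
  by rewrite addr0 (td_eig sys) linearZ /= (td_proj sys) eqxx.
rewrite (td_eig sys) linearZ /= (td_proj sys) ifN ?scaler0 //.
by apply: contra nel => /eqP kl; apply/eqP/val_inj.
Qed.

Lemma proj_eq0 t x : (forall k, e t k x = 0) -> x = 0.
Proof. by move=> e0; rewrite -(td_sum sys t x) big1. Qed.

(** The spans of the word vectors add up to a subspace which is invariant: adding
    the letters k and l in all possible ways to a word vector decomposes its image
    under [M true].  By irreducibility this subspace is V, and projecting V onto
    the i-th eigenspace retains exactly the words that end in i. *)
Lemma shape_bound i : (i <= N false)%N ->
  (\dim (limg (e false i)) <= \dim (limg (e false 0)) * 'C(N true, i))%N.
Proof.
move=> le_iN.
have [S S_P] := fin_all_exists (fun j : 'I_(N false).+1 => words_space j).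
pose W := (\sum_j S j)%VS.
have inW r v : e false 0 v = v -> ~~ odd (size r) -> word_map e r v \in W.
  move=> v0 even_r; have [le_rN|lt_Nr] := leqP (head 0%N r) (N false).
    have [_ inS _] := S_P (Ordinal (le_rN : _ < (N false).+1)%N).
    have: word_map e r v \in S (Ordinal (le_rN : _ < (N false).+1)%N).
      by apply: inS; exists r, v.
    by apply/subvP/(sumv_sup (Ordinal (le_rN : _ < (N false).+1)%N)).
  have := proj_word_map sys r v0.
  by rewrite (negPf even_r) (td_out sys lt_Nr) zero_lfunE => <-; apply: mem0v.
have fW (f : 'End(V)) (U : {vspace V}) :
    (forall j x, word_vector j x -> f x \in U) ->
    forall x, x \in W -> f x \in U.
  move=> fU x /memv_sumP[vs vsS ->]; rewrite linear_sum /= memv_suml // => j _.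
  by have [_ _ subS] := S_P j; apply: subS (vsS j _) => // y; apply: fU.
have word_proj (j k : nat) x :
    word_vector k x -> e false j x = if j == k then x else 0.
  case=> r [v [v0 even_r <- ->]].
  have := proj_word_map sys r v0; rewrite (negPf even_r) => <-.
  by rewrite (td_proj sys); case: eqP => // ->.
have [|W0|Wfull] := @td_irr _ _ _ _ _ _ sys W.
- move=> t; apply/subvP=> _ /memv_imgP[x xW ->]; apply: fW x xW => j x.
  case: t => /= [|wx].
    case=> r [v [v0 even_r _ ->]].
    rewrite -[word_map e r v](td_sum sys true) linear_sum memv_suml // => k _.
    rewrite /= (td_eig sys) memvZ // -[e _ _ _](td_sum sys false).
    rewrite memv_suml // => l _.
    have := inW (nat_of_ord l :: nat_of_ord k :: r) v v0.
    by rewrite !word_map_cons /= !negbK (negPf even_r); apply.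
  have -> : x = e false j x by rewrite (word_proj j j) ?eqxx.
  rewrite (td_eig sys) memvZ // (word_proj j j) // eqxx.
  by case: wx => r [v [v0 even_r _ ->]]; apply: inW.
- case/eqP: (td_neq0 sys (leq0n (N false))); apply/lfunP => x; rewrite zero_lfunE.
  apply/eqP; rewrite -memv0 -W0 -[e _ _ _](id_lfunE).
  by apply: (inW [::]) => //; rewrite (td_proj sys).
have [dimS _ subS] := S_P (Ordinal (le_iN : i < (N false).+1)%N).
apply: leq_trans dimS; apply/dimvS/subvP => _ /memv_imgP[x _ ->].
have: x \in W by rewrite Wfull memvf.
apply: fW => j {}x wx; rewrite (word_proj i j) //.
case: eqP => [eq_ij|_]; last exact: mem0v.
have [_ inS _] := S_P (Ordinal (le_iN : i < (N false).+1)%N).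
by apply: inS; rewrite /= eq_ij.
Qed.

(** Write E_k and F_k for the eigenspaces of [M false] and [M true], d = N false,
    and let U_i = (F_0 + ... + F_i) :&: (E_i + ... + E_d) for 0 <= i <= d.  Then
    [M true] - [a true i] maps U_i into U_{i-1}, and [M false] - [a false i] maps
    U_i into U_{i+1}, so the sum of the U_i is invariant.  It contains U_0 = F_0,
    hence equals V, although it is contained in F_0 + ... + F_d. *)
Lemma diameter_le : (N true <= N false)%N.
Proof.
rewrite leqNgt; apply/negP => lt_NN.
pose U (i : nat) := (lker (\sum_(k < (N true).+1 | (i < k)%N) e true k)%R
  :&: lker (\sum_(k < (N false).+1 | (k < i)%N) e false k)%R)%VS.
have lkerP t (P : pred nat) x :
    x \in lker (\sum_(k < (N t).+1 | P k) e t k)%R <->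
    forall k, P k -> e t k x = 0.
  rewrite memv_ker sum_lfunE; split=> [/eqP sum0 k Pk|e0]; last first.
    by rewrite big1 // => k; apply: e0.
  have [le_kN|lt_Nk] := leqP k (N t); last first.
    by rewrite (td_out sys lt_Nk) zero_lfunE.
  have := congr1 (e t k) sum0; rewrite linear0 linear_sum.
  rewrite (bigD1 (Ordinal (le_kN : k < (N t).+1)%N)) //=.
  rewrite big1 => [|l /andP[_ nel]].
    by rewrite addr0 (td_proj sys) eqxx.
  rewrite (td_proj sys) ifN //.
  by apply: contra nel => /eqP kl; apply/eqP/val_inj.
have inU i x : x \in U i <->
    (forall k, (i < k)%N -> e true k x = 0) /\
    (forall k, (k < i)%N -> e false k x = 0).
  rewrite memv_cap -(lkerP true (fun k => i < k)%N).
  rewrite -(lkerP false (fun k => k < i)%N).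
  by split=> /andP.
pose W := (\sum_(i < (N false).+1) U i)%VS.
have inW i x : (i <= N false)%N -> x \in U i -> x \in W.
  by move=> le_i; apply/subvP/(sumv_sup (Ordinal (le_i : i < (N false).+1)%N)).
have tri_comp t l x (P : pred nat) : (forall k, ~~ P k -> e t k x = 0) ->
    (forall k, P k -> (k.+1 < l) || (l.+1 < k))%N -> e t l (M (~~ t) x) = 0.
  move=> e0 far; rewrite -(td_sum sys t x) !linear_sum big1 // => k _ /=.
  have [/far|/e0->] := boolP (P k); last by rewrite !linear0.
  by move/(td_tri sys).
have [|W0|Wfull] := @td_irr _ _ _ _ _ _ sys W.
- move=> t; apply/subvP=> _ /memv_imgP[x /memv_sumP[vs vsU ->] ->].
  rewrite linear_sum memv_suml //= => i _; have /= := vsU i isT.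
  move: (vs i) => {vs vsU}x xU.
  have xW : x \in W by apply: inW xU; rewrite -ltnS.
  case/inU: (xU) => x_hi x_lo.
  rewrite -(subrK (a t i *: x) (M t x)) memvD ?memvZ //.
  case: t.
    case: (posnP i) => [i0|i_gt0].
      rewrite (_ : _ - _ = 0) ?mem0v //; apply: (@proj_eq0 true) => k.
      rewrite linearB linearZ /= proj_comm; case: (posnP k) => [->|k_gt0].
        by rewrite i0 subrr.
      by rewrite x_hi ?i0 // !scaler0 subrr.
    apply: (inW i.-1); first by rewrite (leq_trans (leq_pred _)) // -ltnS.
    apply/inU; split=> k lt_k; rewrite linearB linearZ /=.
      rewrite proj_comm; have [->|ne_ki] := eqVneq k i; first by rewrite subrr.
      by rewrite x_hi ?scaler0 ?subrr //; move/eqP: ne_ki; lia.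
    rewrite x_lo; last by lia.
    rewrite scaler0 subr0; apply: (tri_comp false _ _ (fun k => i <= k)%N).
      by move=> l; rewrite -ltnNge; apply: x_lo.
    by move=> l; lia.
  have y_lo k : (k <= i)%N -> e false k (M false x - a false i *: x) = 0.
    rewrite linearB linearZ /= proj_comm => le_ki.
    have [->|ne_ki] := eqVneq k i; first by rewrite subrr.
    by rewrite x_lo ?scaler0 ?subrr //; move/eqP: ne_ki; lia.
  have [lt_iN|le_Ni] := ltnP i (N false).
    apply: (inW i.+1) => //; apply/inU; split=> k lt_k; last exact: y_lo.
    rewrite linearB linearZ /= x_hi; last by lia.
    rewrite scaler0 subr0; apply: (tri_comp true _ _ (fun k => k <= i)%N).
      by move=> l; rewrite -ltnNge; apply: x_hi.
    by move=> l; lia.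
  rewrite (_ : _ - _ = 0) ?mem0v //; apply: (@proj_eq0 false) => k.
  have [le_kN|lt_Nk] := leqP k (N false).
    by rewrite y_lo // (leq_trans le_kN).
  by rewrite (td_out sys lt_Nk) zero_lfunE.
- case/eqP: (td_neq0 sys (leq0n (N true))); apply/lfunP => x; rewrite zero_lfunE.
  apply/eqP; rewrite -memv0 -W0; apply: (inW 0%N) => //; apply/inU; split=> // k.
  by rewrite (td_proj sys); case: k.
case/eqP: (td_neq0 sys (leqnn (N true))); apply/lfunP => x; rewrite zero_lfunE.
have: x \in W by rewrite Wfull memvf.
case/memv_sumP=> vs vsU ->; rewrite linear_sum big1 // => i _ /=.
case/inU: (vsU i isT) => x_hi _; apply: x_hi.
by apply: leq_ltn_trans lt_NN; rewrite -ltnS.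
Qed.

End Shape.

(** * The system of a tridiagonal pair *)

Section Projections.

Variables (K : fieldType) (V : vectType K).

Lemma memv_eigenspace (A : 'End(V)) theta x :
  (x \in passmx.leigenspace A theta) = (A x == theta *: x).
Proof.
by rewrite memv_ker !lfun_simp subr_eq0.
Qed.

Lemma eigenvectors_independent (A : 'End(V)) n (a : 'I_n -> K) (x : 'I_n -> V) :
  injective a -> (forall i, A (x i) = a i *: x i) -> \sum_i x i = 0 ->
  forall i, x i = 0.
Proof.
move=> a_inj Ax sum0 i.
have sumX r : \sum_j a j ^+ r *: x j = 0.
  elim: r => [|r IHr].
    by rewrite -[RHS]sum0; apply: eq_bigr => j _; rewrite scale1r.
  have := congr1 A IHr; rewrite linear0 linear_sum => sumA.
  rewrite -[RHS]sumA; apply: eq_bigr => j _.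
  by rewrite linearZ /= Ax scalerA exprSr.
pose p : {poly K} := \prod_(j | j != i) ('X - (a j)%:P).
have sump : \sum_j p.[a j] *: x j = 0.
  under eq_bigr => j _ do rewrite horner_coef scaler_suml.
  rewrite exchange_big big1 // => r _.
  under eq_bigr => j _ do rewrite -scalerA.
  by rewrite -scaler_sumr sumX scaler0.
move: sump; rewrite (bigD1 i) //= [X in _ + X]big1 => [|j ne_ji]; last first.
  by rewrite horner_prod (bigD1 j) //= hornerXsubC subrr mul0r scale0r.
rewrite addr0 => /eqP; rewrite scaler_eq0 => /orP[|/eqP//].
rewrite horner_prod => /prodf_eq0[j ne_ji]; rewrite hornerXsubC subr_eq0.
by move/eqP/a_inj=> eq_ij; rewrite eq_ij eqxx in ne_ji.
Qed.

Lemma eigenspace_projections (A : 'End(V)) d (E : d.+1.-tuple {vspace V}) :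
  diagonalizable_lfun A -> eigenspace_ordering A E ->
  exists (e : nat -> 'End(V)) (a : nat -> K),
  [/\ forall x, \sum_(k < d.+1) e k x = x,
      forall i j x, e i (e j x) = if i == j then e i x else 0
    & [/\ forall i, (d < i)%N -> e i = 0,
      forall k x, A (e k x) = a k *: e k x,
      forall i j, (i <= d)%N -> (j <= d)%N -> a i = a j -> i = j
    & forall i, limg (e i) = nth 0%VS E i]].
Proof.
move=> [s [s_eig s_full]] [E_uniq E_eig].
have [th thE] := fin_all_exists (fun i => proj2 ((E_eig _).1 (mem_tnth i E))).
have th_inj : injective th.
  move=> i j eq_th; apply/val_inj/eqP.
  rewrite -(nth_uniq 0%VS _ _ E_uniq) ?size_tuple ?ltn_ord //.
  by rewrite -!tnth_nth !thE eq_th.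
have E_full : (\sum_i tnth E i)%VS = fullv.
  apply/eqP; rewrite eqEsubv subvf -s_full /=.
  rewrite big_seq; elim/big_ind: _ => [||U Us].
  - exact: sub0v.
  - by move=> U1 U2 sU1 sU2; rewrite subv_add sU1.
  - by have /tnthP[j ->] := (E_eig U).2 (s_eig U Us); apply: (sumv_sup j).
pose V0 := (\sum_i tnth E i)%VS.
pose e k : 'End(V) := if insub k is Some i then sumv_pi V0 i else 0.
have eE (i : 'I_d.+1) : e i = sumv_pi V0 i by rewrite /e valK.
have e_out k : (d < k)%N -> e k = 0.
  by move=> lt_dk; rewrite /e insubF // ltnS leqNgt lt_dk.
have sum_e x : \sum_(k < d.+1) e k x = x.
  under eq_bigr => k _ do rewrite eE.
  by apply: sumv_pi_sum; rewrite /V0 E_full memvf.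
have e_mem k x : e k x \in nth 0%VS E k.
  have [le_kd|lt_dk] := leqP k d; last by rewrite e_out // zero_lfunE mem0v.
  rewrite -[k]/(nat_of_ord (Ordinal (le_kd : k < d.+1)%N)) eE -tnth_nth.
  exact: memv_sum_pi.
have memE (i : 'I_d.+1) x : x \in nth 0%VS E i -> A x = th i *: x.
  by rewrite -tnth_nth thE memv_eigenspace => /eqP.
have e_id i j x : x \in nth 0%VS E j -> e i x = if i == j then x else 0.
  have [le_jd|lt_dj] := leqP j d; last first.
    rewrite nth_default ?size_tuple // memv0 => /eqP->.
    by rewrite linear0 if_same.
  have [le_id|lt_di] := leqP i d; last first.
    by rewrite e_out // zero_lfunE gtn_eqF // (leq_ltn_trans le_jd).
  pose i' := Ordinal (le_id : i < d.+1)%N.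
  pose j' := Ordinal (le_jd : j < d.+1)%N.
  move=> xE; have := @eigenvectors_independent A _ th
    (fun k : 'I_d.+1 => e k x - (if k == j' then x else 0)) th_inj.
  move/(_ _ _ i')/eqP; rewrite subr_eq0 => /(_ _ _)/eqP-> //.
  - move=> k; rewrite linearB /= scalerBr (memE k) //; congr (_ - _).
    by case: eqP => [->|_]; rewrite ?linear0 ?scaler0 ?(memE j').
  - by rewrite sumrB sum_e -big_mkcond big_pred1_eq subrr.
exists e, (fun k => if insub k is Some i then th i else 0).
split=> //; last split=> //.
- by move=> i j x; rewrite (e_id i j) //; case: eqP => [->|].
- move=> k x; have [le_kd|lt_dk] := leqP k d; last first.
    by rewrite e_out // zero_lfunE linear0 scaler0.
  rewrite -[k]/(nat_of_ord (Ordinal (le_kd : k < d.+1)%N)) valK.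
  exact: memE.
- move=> i j le_id le_jd.
  rewrite -[i]/(nat_of_ord (Ordinal (le_id : i < d.+1)%N)).
  rewrite -[j]/(nat_of_ord (Ordinal (le_jd : j < d.+1)%N)) !valK.
  by move/th_inj->.
- move=> i; apply/eqP; rewrite eqEsubv; apply/andP; split.
    by apply/subvP=> _ /memv_imgP[x _ ->].
  apply/subvP=> x xE; rewrite -[x](_ : e i x = x) ?memv_img ?memvf //.
  by rewrite (e_id i i) ?eqxx.
Qed.

Lemma far_projection (A As : 'End(V)) d (E : d.+1.-tuple {vspace V})
    (e : nat -> 'End(V)) i j x :
  standard_ordering A As E ->
  (forall i j x, e i (e j x) = if i == j then e i x else 0) ->
  (forall i, limg (e i) = nth 0%VS E i) ->
  (i.+1 < j)%N || (j.+1 < i)%N -> e j (As (e i x)) = 0.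
Proof.
move=> [_ E_tri] ee limE far.
have [le_id|lt_di] := leqP i d; last first.
  have: e i x \in limg (e i) by rewrite memv_img ?memvf.
  rewrite limE nth_default ?size_tuple // memv0 => /eqP->.
  by rewrite !linear0.
have kill k y : y \in nth 0%VS E k -> k != j -> e j y = 0.
  by rewrite -limE => /memv_imgP[z _ ->] ne_kj; rewrite ee eq_sym (negPf ne_kj).
have: As (e i x) \in (As @: nth 0%VS E i)%VS.
  by rewrite memv_img // -limE memv_img ?memvf.
move/(subvP (E_tri i le_id)).
case/memv_addP=> _ /memv_addP[y1 y1E [y2 y2E ->]] [y3 y3E ->].
rewrite !linearD /= (kill _ _ y2E) ?(kill _ _ y3E) ?addr0; try lia.
move: far y1E; case: (i) => [|k] far_k y1E.
  by move: y1E; rewrite memv0 => /eqP->; rewrite linear0.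
by rewrite (kill _ _ y1E) //; lia.
Qed.

Lemma pair_td_system (A As : 'End(V)) d (E : d.+1.-tuple {vspace V})
    delta (Es : delta.+1.-tuple {vspace V}) :
  diagonalizable_lfun A -> diagonalizable_lfun As ->
  standard_ordering A As E -> standard_ordering As A Es ->
  ~ (exists W, [/\ (A @: W <= W)%VS, (As @: W <= W)%VS,
                   W != 0%VS & W != fullv]) ->
  exists e a,
    td_system (fun t => if t then delta else d)
              (fun t => if t then As else A) e a /\
    forall i, limg (e false i) = nth 0%VS E i.
Proof.
move=> diagA diagAs stE stEs irr.
have [e [a [sum_e ee [e_out eig_e inj_a limE]]]] :=
  eigenspace_projections diagA stE.1.
have [f [b [sum_f ff [f_out eig_f inj_b limF]]]] :=
  eigenspace_projections diagAs stEs.1.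
exists (fun t => if t then f else e), (fun t => if t then b else a).
have neq0 B n (G : n.+1.-tuple {vspace V}) (g : nat -> 'End(V)) i :
    eigenspace_ordering B G -> limg (g i) = nth 0%VS G i ->
    (i <= n)%N -> g i != 0.
  move=> [_ G_eig] limg_g le_in; apply/eqP=> g0.
  have /G_eig[] : nth 0%VS G i \in G by rewrite mem_nth ?size_tuple.
  by rewrite -limg_g g0 lim0g eqxx.
split=> //; split; try by case.
- by case=> i; [apply: neq0 stEs.1 _ | apply: neq0 stE.1 _].
- case=> i j x; first exact: far_projection stEs _ _.
  exact: far_projection stE _ _.
move=> W invW; have [->|W0] := eqVneq W 0%VS; first by left.
have [->|W1] := eqVneq W fullv; first by right.
case: irr; exists W; split=> //; [exact: (invW false) | exact: (invW true)].
Qed.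

End Projections.

Theorem theorem1p3 (K : fieldType) (V : vectType K)
    (hV : (0 < \dim (fullv : {vspace V}))%N)
    (A As : 'End(V)) (hA : tridiagonal_pair A As)
    (d : nat) (rho : 'I_d.+1 -> nat) (hrho : has_diameter_shape A As rho) :
  forall i : 'I_d.+1, (rho i <= rho ord0 * 'C(d, i))%N.
Proof.
wlog [E stE rhoE] : A As hA hrho / exists2 E : d.+1.-tuple {vspace V},
    standard_ordering A As E & forall i, rho i = \dim (tnth E i).
  move=> thm; case: (hrho) => E [[stE|stE] rhoE].
    by apply: (thm A As) => //; exists E.
  apply: (thm As A); last by exists E.
    case: hA => -[dA dAs] exE exEs irr; split=> //.
    by case=> W [sA sAs W0 W1]; case: irr; exists W; split.
  by exists E; split=> //; left.
case: hA => -[dA dAs] _ [delta [Es stEs]] irr i.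
have [e [a [sys limE]]] := pair_td_system dA dAs stE stEs irr.
have := shape_bound sys (i := i); rewrite -ltnS ltn_ord => /(_ isT).
rewrite !limE !rhoE !(tnth_nth 0%VS) => /leq_trans; apply.
by rewrite leq_mul2l leq_bin2l ?orbT //; apply: diameter_le sys.
Qed.
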